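(* Let $X$ be a finite set with $|X|=v$, let $k\le v/2$, let $C$ be a completely transitive design in $J(v,k)$ with $|C|\ge2$ and minimum distance $\delta\ge3$, and let $\alpha\in C$. Then the setwise stabiliser $\mathrm{Aut}(C)_\alpha$ is transitive on the Cartesian product $\alpha\times(X\setminus\alpha)$. Further, one of the following holds: (a) $v=2k\ge6$ and $C$ consists of two disjoint $k$-subsets; (b) $v=3b$ for some integer $b$, and $C$ consists of $b$ pairwise disjoint triples; (c) $\mathrm{Aut}(C)$ is 2-transitive on $X$.
   Context: The Johnson graph $J(v,k)$ has as vertices the $k$-subsets of a fixed $v$-set $X$, two being adjacent if they have exactly $k-1$ points in common. For a nonempty set $C$ of vertices, the distance partition with respect to $C$ is the partition $C_0=C,C_1,\ldots,C_r$ where $C_i$ consists of the vertices whose minimum distance to a vertex of $C$ is $i$, and $r$ is the maximum such distance. $\mathrm{Aut}(C)$ is the group of permutations of $X$ that map $C$ to itself in the induced action on $k$-subsets. $C$ is a completely transitive design if the cells of its distance partition are the orbits of $\mathrm{Aut}(C)$ on the $k$-subsets of $X$. The minimum distance $\delta$ of $C$ is the minimum distance in $J(v,k)$ between two distinct vertices of $C$ (so $\delta\ge3$ means any two distinct members of $C$ have at most $k-3$ points in common). *)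

(* Defs.v *)
From mathcomp Require Import all_boot all_fingroup all_solvable.

Set Implicit Arguments.
Unset Strict Implicit.
Unset Printing Implicit Defensive.

Section GraphDistance.

Variables (T : finType) (e : rel T).

Definition has_walk (n : nat) (x y : T) : bool :=
  [exists p : n.-tuple T, path e x p && (last x p == y)].

(* Connected vertices are joined by a walk of length < #|T|, so the value   *)
(* #|T| of [find] occurs exactly when x and y are not connected. The minima *)
(* below use the same value #|T| over an empty range.                       *)
Definition gdist (x y : T) : nat :=
  find (fun n => has_walk n x y) (iota 0 #|T|).

Definition gdist_set (C : {set T}) (x : T) : nat :=
  \big[minn/#|T|]_(y in C) gdist x y.

Definition min_gdist (C : {set T}) : nat :=
  \big[minn/#|T|]_(x in C) \big[minn/#|T|]_(y in C | y != x) gdist x y.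

End GraphDistance.

Section Johnson.

Variables (X : finType) (k : nat).
Implicit Types (C : {set {set X}}) (A B : {set X}).

Definition ksubsets : {set {set X}} := [set A : {set X} | #|A| == k].

(* J(v,k) is carried by {set X}, with every set outside [ksubsets] isolated. *)
(* The successor avoids truncated subtraction when k = 0.                    *)
Definition johnson : rel {set X} :=
  [rel A B | [&& A \in ksubsets, B \in ksubsets & #|A :&: B|.+1 == k]].

Definition dist_cell C (i : nat) : {set {set X}} :=
  [set A in ksubsets | gdist_set johnson C A == i].

Definition covering_radius C : nat :=
  \max_(A in ksubsets) gdist_set johnson C A.

Definition dist_partition C : {set {set {set X}}} :=
  [set dist_cell C i | i : 'I_(covering_radius C).+1].

Definition Aut_design C : {group {perm X}} := 'N(C | 'P^*)%G.

Definition completely_transitive C : Prop :=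
  [/\ C != set0, C \subset ksubsets
    & dist_partition C = [set orbit 'P^* (Aut_design C) A | A in ksubsets]].

End Johnson.

Section PairAction.

Variable X : finType.

Definition pair_perm (z : X * X) (s : {perm X}) : X * X := (s z.1, s z.2).

Lemma pair_perm1 : pair_perm^~ 1%g =1 id.
Proof. by case=> x y; rewrite /pair_perm !perm1. Qed.

Lemma pair_permM (z : X * X) : act_morph pair_perm z.
Proof. by move=> s t; rewrite /pair_perm !permM. Qed.

Canonical pair_action : {action {perm X} &-> X * X} :=
  TotalAction pair_perm1 pair_permM.

End PairAction.

(* Main.v *)
(**
  The distance in J(v,k) is |A \ B|, so delta >= 3 makes every neighbour of a
  codeword alpha adjacent to no other codeword; as C_1 is an orbit, Aut(C)_alpha
  permutes the neighbours alpha - a + x transitively. Hence Aut(C) is transitive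
  on X. Call two points equivalent if they lie in the same codewords. If
  equivalence is equality, any a and x <> a are separated by a codeword, and
  Aut(C) is 2-transitive. Otherwise codewords are unions of blocks of size at
  least 2. For suitable a1, a2 in alpha, every alpha - {a1, a2} + {x1, x2} lies
  in C_2, and the number of blocks it meets depends on whether x1 and x2 are
  equivalent; since C_2 is an orbit, this is only possible if codewords are
  single blocks and either X \ alpha is also a block or k = 3.
*)
Require Import Defs.
From mathcomp Require Import all_boot all_fingroup all_solvable.
From mathcomp Require Import zify.

Set Implicit Arguments.
Unset Strict Implicit.
Unset Printing Implicit Defensive.

(** * Minima over ranges, least indices, and 2-transitivity of permutation groups *)

Lemma bigminn_le (I : eqType) (r : seq I) (P : pred I) (F : I -> nat) d i0 :
  i0 \in r -> P i0 -> \big[minn/d]_(i <- r | P i) F i <= F i0.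
Proof.
elim: r => // i r IHr; rewrite inE big_cons => /orP[/eqP <- Pi0|ri0 Pi0].
  by rewrite Pi0 geq_minl.
case: ifP => _; last exact: IHr.
by apply: leq_trans (IHr ri0 Pi0); apply: geq_minr.
Qed.

(** The default [d] takes part in every such minimum, so it has to be bounded as well. *)
Lemma leq_bigminn (I : eqType) (r : seq I) (P : pred I) (F : I -> nat) d m :
  m <= d -> (forall i, i \in r -> P i -> m <= F i) ->
  m <= \big[minn/d]_(i <- r | P i) F i.
Proof.
move=> le_m leF; rewrite big_seq_cond.
by elim/big_ind: _ => [|x y|i /andP[]] //;
  [rewrite leq_min => -> -> | apply: leF].
Qed.

Lemma find_iota0 (a : pred nat) n m :
  a n -> n < m -> (forall i, a i -> n <= i) -> find a (iota 0 m) = n.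
Proof.
move=> an lt_nm min_n; rewrite -(subnKC (ltnW lt_nm)) iotaD find_cat.
rewrite (introF (@hasP _ _ _)) => [|[i]]; last first.
  by rewrite mem_iota /= add0n => lt_in /min_n; rewrite leqNgt lt_in.
by rewrite size_iota; case: (m - n) (lt_nm) => [|j]; rewrite /= ?an ?addn0 //;
  lia.
Qed.

Lemma imset_permD (X : finType) (g : {perm X}) (A B : {set X}) :
  g @: (A :\: B) = (g @: A) :\: (g @: B).
Proof.
apply/setP=> y; rewrite -(permKV g y) inE !mem_imset ?inE //; exact: perm_inj.
Qed.

Lemma transitive2_perm (X : finType) (G : {group {perm X}}) (x0 y0 : X) :
    x0 != y0 ->
    (forall x y, x != y -> exists2 g, g \in G & g x0 = x /\ g y0 = y) ->
  [transitive^2 G, on [set: X] | 'P].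
Proof.
have dtuple2 (x y : X) : ([tuple x; y] \in 2.-dtuple([set: X])) = (x != y).
  rewrite inE /= inE andbT andbC; case: (x != y); rewrite ?andbF // andbT.
  by apply/subsetP=> z; rewrite inE.
move=> neq0 trG; apply/imsetP; exists [tuple x0; y0]; first by rewrite dtuple2.
apply/setP=> t; case/tupleP: t => x t; case/tupleP: t => y t;
  rewrite (tuple0 t).
apply/idP/imsetP=> [|[g _ def_t]].
  rewrite dtuple2 => /trG[g Gg [<- <-]]; exists g => //; exact: val_inj.
case: def_t => -> ->; rewrite dtuple2.
by rewrite (inj_eq (act_inj _ _)).
Qed.

(** * Distance in the Johnson graph as the size of a set difference *)

Section Johnson.

Variable X : finType.
Implicit Types (A B D : {set X}) (C : {set {set X}}).

Lemma card_setD_triangle A B D : #|A :\: D| <= #|A :\: B| + #|B :\: D|.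
Proof.
apply: leq_trans (leq_card_setU _ _); apply/subset_leq_card/subsetP=> x.
by rewrite !inE => /andP[-> ->]; rewrite andbT andTb orNb.
Qed.

Lemma card_setD_sym A B : #|A| = #|B| -> #|A :\: B| = #|B :\: A|.
Proof. by move=> eqAB; rewrite !cardsD setIC eqAB. Qed.

Definition exchange A (a x : X) := x |: (A :\ a).

Lemma card_exchange A a x : a \in A -> x \notin A -> #|exchange A a x| = #|A|.
Proof.
by move=> Aa A'x; rewrite cardsU1 !inE (negPf A'x) andbF (cardsD1 a A) Aa.
Qed.

Lemma exchange_setDl A a x :
  a \in A -> x \notin A -> A :\: exchange A a x = [set a].
Proof.
move=> Aa A'x; apply/setP=> z; rewrite !inE; have [->|_] := eqVneq z a.
  by rewrite Aa /= orbF andbT; apply: contraNneq A'x => <-.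
by rewrite /= negb_or andbC; case: (z \in A); rewrite ?andbF.
Qed.

Lemma exchange_setDr A a x : x \notin A -> exchange A a x :\: A = [set x].
Proof.
move=> A'x; apply/setP=> z; rewrite !inE.
by have [->|_] := eqVneq z x; [rewrite A'x | case: (z \in A); rewrite ?andbF].
Qed.

Variable k : nat.

Lemma in_ksubsets A : (A \in ksubsets X k) = (#|A| == k).
Proof. by rewrite inE. Qed.

(** An edge from A to D has |A \ D| = 1, so by the triangle inequality each step lowers the
    difference to B by at most one. *)
Lemma walk_setD n A B :
  A \in ksubsets X k -> has_walk (johnson k) n A B -> #|A :\: B| <= n.
Proof.
move=> kA /existsP[p /andP[]]; rewrite -[leqRHS](size_tuple p).
elim: {n p}(tval p) A kA => [|D p IHp] A kA /=.
  by move=> _ /eqP->; rewrite setDv cards0.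
case/andP=> /and3P[_ kD AD] Dp lastB; have leD := IHp D kD Dp lastB.
have AD1 : #|A :\: D| = 1.
  by move: kA; rewrite in_ksubsets -(eqP AD) -(cardsID D A)
    -addn1 eqn_add2l => /eqP.
by apply: leq_trans (card_setD_triangle A D B) _; rewrite AD1.
Qed.

(** Exchanging a point of A \ B for a point of B \ A is an edge that brings A one step closer to
    B. *)
Lemma setD_walk n A B : A \in ksubsets X k -> B \in ksubsets X k ->
  #|A :\: B| = n -> has_walk (johnson k) n A B.
Proof.
elim: n A => [|n IHn] A kA kB dAB.
  apply/existsP; exists [tuple] => /=; rewrite eqEcard.
  move: kA kB; rewrite !in_ksubsets => /eqP-> /eqP->.
  by rewrite leqnn andbT -setD_eq0 -cards_eq0 dAB.
have eqAB : #|A| = #|B| by move: kA kB; rewrite !in_ksubsets => /eqP-> /eqP.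
have /card_gt0P[a] : 0 < #|A :\: B| by rewrite dAB.
have /card_gt0P[b] : 0 < #|B :\: A| by rewrite -card_setD_sym // dAB.
rewrite !inE => /andP[A'b Bb] /andP[B'a Aa].
have kA' : exchange A a b \in ksubsets X k.
  by rewrite in_ksubsets card_exchange // -in_ksubsets.
have /existsP[p /andP[pP lastP]] : has_walk (johnson k) n (exchange A a b) B.
  apply: IHn => //; apply/eqP; rewrite -eqSS -dAB (cardsD1 a (A :\: B)) !inE.
  rewrite B'a Aa add1n eqSS; apply/eqP/eq_card=> x; rewrite !inE.
  by case: (x =P b) => [->|_]; [rewrite Bb andbF | rewrite orFb andbCA].
apply/existsP; exists [tuple of exchange A a b :: p].
rewrite /= pP lastP !andbT; apply/and3P; split=> //.
have ->: A :&: exchange A a b = A :\ a.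
  apply/setP=> x; rewrite !inE.
  case: (x =P b) => [->|_]; first by rewrite (negPf A'b) andbF.
  by rewrite orFb andbCA andbb.
by move: kA; rewrite in_ksubsets (cardsD1 a A) Aa.
Qed.

(** This keeps every distance strictly below the default value of [gdist] and [gdist_set], so the
    search in [gdist] does succeed. *)
Lemma card_lt_set A : #|A| < #|{set X}|.
Proof.
have <-: #|powerset [set: X]| = #|{set X}| by rewrite powersetT cardsT.
rewrite card_powerset cardsT; apply: leq_ltn_trans (max_card _) _.
exact: ltn_expl.
Qed.

Lemma gdist_johnson A B : A \in ksubsets X k -> B \in ksubsets X k ->
  gdist (johnson k) A B = #|A :\: B|.
Proof.
move=> kA kB; apply: find_iota0; first exact: setD_walk.
- exact: card_lt_set.
- by move=> n; apply: walk_setD.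
Qed.

Lemma gdist_set_johnson C A i : C \subset ksubsets X k -> A \in ksubsets X k ->
    {in C, forall B, i <= #|A :\: B|} ->
      (exists2 B, B \in C & #|A :\: B| <= i) ->
  gdist_set (johnson k) C A = i.
Proof.
move=> /subsetP kC kA le_i [B CB leB]; apply/eqP; rewrite eqn_leq; apply/andP;
  split.
  apply: leq_trans leB; rewrite -gdist_johnson ?(kC B) // /gdist_set.
  by apply: bigminn_le CB; rewrite mem_index_enum.
apply: leq_bigminn => [|D _ CD]; last by rewrite gdist_johnson ?(kC D) // le_i.
exact: leq_trans (le_i B CB) (ltnW (card_lt_set _)).
Qed.

Lemma min_gdist_johnson C A B : C \subset ksubsets X k ->
  A \in C -> B \in C -> A != B -> min_gdist (johnson k) C <= #|A :\: B|.
Proof.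
move=> /subsetP kC CA CB neqAB; rewrite -gdist_johnson ?kC // /min_gdist.
apply: leq_trans (bigminn_le _ _ (mem_index_enum A) CA) _.
by apply: bigminn_le (mem_index_enum B) _; rewrite CB eq_sym.
Qed.

Lemma completely_transitive_orbit C A B :
    completely_transitive k C -> A \in ksubsets X k -> B \in ksubsets X k ->
    gdist_set (johnson k) C A = gdist_set (johnson k) C B ->
  exists2 g, g \in Aut_design C & B = g @: A.
Proof.
case=> _ _ cellsP kA kB eqAB; set i := gdist_set _ _ A in eqAB.
have lt_i : i < (covering_radius k C).+1.
  by rewrite ltnS; apply: (@leq_bigmax_cond _ _ (gdist_set (johnson k) C) A kA).
have : dist_cell k C i \in dist_partition k C.
  by apply/imsetP; exists (Ordinal lt_i).
rewrite cellsP => /imsetP[D kD cellD].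
have /orbitP[g Gg gA] : A \in orbit 'P^* (Aut_design C) D.
  by rewrite -cellD inE kA eqxx.
have /orbitP[h Gh hB] : B \in orbit 'P^* (Aut_design C) D.
  by rewrite -cellD inE kB eqAB eqxx.
exists (g^-1 * h)%g; first by rewrite groupM ?groupV.
by rewrite -hB -[D](actK 'P^* g) gA -actM.
Qed.

End Johnson.

(** * Transitivity on neighbours of a codeword and on points *)

Section CompletelyTransitive.

Variables (X : finType) (k : nat) (C : {set {set X}}).
Hypothesis le_k : 2 * k <= #|X|.
Hypothesis ct_C : completely_transitive k C.
Hypothesis card_C : 2 <= #|C|.
Hypothesis delta_C : 3 <= min_gdist (johnson k) C.

Implicit Types (x y z : X) (A B D : {set X}) (g : {perm X}).

Let G := Aut_design C.

Let subC : C \subset ksubsets X k.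
Proof. by case: ct_C. Qed.

Let cardC A : A \in C -> #|A| = k.
Proof. by move/(subsetP subC); rewrite in_ksubsets => /eqP. Qed.

Lemma codeword_dist A B : A \in C -> B \in C -> A != B -> 3 <= #|A :\: B|.
Proof.
by move=> CA CB neqAB; apply: leq_trans delta_C (min_gdist_johnson _ CA CB _).
Qed.

Lemma Aut_designP g A : g \in G -> (g @: A \in C) = (A \in C).
Proof. by move=> Gg; rewrite -(astabs_act A Gg). Qed.

Lemma codeword_transitive A B :
  A \in C -> B \in C -> exists2 g, g \in G & B = g @: A.
Proof.
have dist0 D : D \in C -> gdist_set (johnson k) C D = 0.
  move=> CD; apply: gdist_set_johnson => //; first exact: (subsetP subC D CD).
  by exists D; rewrite ?setDv ?cards0.
move=> CA CB; apply: (completely_transitive_orbit ct_C); last by rewrite !dist0.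
  exact: (subsetP subC A CA).
exact: (subsetP subC B CB).
Qed.

(** The exchanged set is at distance 1 from A, and B is at distance at least 3 from A. *)
Lemma exchange_dist A B a x :
  A \in C -> B \in C -> A != B -> a \in A -> x \notin A ->
  2 <= #|exchange A a x :\: B|.
Proof.
move=> CA CB neqAB Aa A'x; rewrite -ltnS;
  apply: leq_trans (codeword_dist CA CB neqAB) _.
apply: leq_trans (card_setD_triangle A (exchange A a x) B) _.
by rewrite exchange_setDl // cards1.
Qed.

(* By [exchange_dist] a neighbour of a codeword is adjacent to no other codeword,
   so an automorphism moving one neighbour of A to another fixes A. *)
Lemma pair_transitive A a b x y :
    A \in C -> a \in A -> b \in A -> x \notin A -> y \notin A ->
  exists2 g, g \in G & [/\ g @: A = A, g a = b & g x = y].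
Proof.
move=> CA Aa Ab A'x A'y.
have kE c z : c \in A -> z \notin A -> exchange A c z \in ksubsets X k.
  by move=> Ac A'z; rewrite in_ksubsets card_exchange ?cardC.
have dist1 c z : c \in A -> z \notin A ->
  gdist_set (johnson k) C (exchange A c z) = 1.
  move=> Ac A'z; apply: gdist_set_johnson => //; first exact: kE.
    move=> B CB; have [<-|neqAB] := eqVneq A B;
      first by rewrite exchange_setDr ?cards1.
    exact: ltnW (exchange_dist _ _ _ _ _).
  by exists A; rewrite ?exchange_setDr ?cards1.
have [g Gg gE] : exists2 g, g \in G & exchange A b y = g @: exchange A a x.
  by apply: (completely_transitive_orbit ct_C);
    [exact: kE | exact: kE | rewrite !dist1].
have gA : g @: A = A.
  apply/eqP/negPn/negP; rewrite eq_sym => neqA.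
  have CgA : g @: A \in C by rewrite Aut_designP.
  have := exchange_dist CA CgA neqA Ab A'y.
  by rewrite gE -imset_permD exchange_setDr // imset_set1 cards1.
(* As g fixes A and maps one neighbour to the other, it maps the removed point a to b and the added
   point x to y. *)
exists g => //; split=> //; apply: set1_inj.
  by rewrite -(exchange_setDl Ab A'y) gE -imset_set1 -(exchange_setDl Aa A'x)
    imset_permD gA.
by rewrite -(exchange_setDr b A'y) gE -imset_set1 -(exchange_setDr a A'x)
  imset_permD gA.
Qed.

Lemma other_codeword A : exists2 B, B \in C & B != A.
Proof.
case/card_gt1P: card_C => B [D [CB CD neqBD]].
have [eqBA|neqBA] := eqVneq B A; last by exists B.
by exists D; rewrite // -eqBA eq_sym.
Qed.

Lemma codeword_outside A B :
  A \in C -> B \in C -> B != A -> exists2 z, z \in B & z \notin A.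
Proof.
move=> CA CB neqBA; apply/subsetPn; apply: contra neqBA => sBA.
by rewrite eqEcard sBA (cardC CA) (cardC CB) leqnn.
Qed.

Lemma k_gt2 : 2 < k.
Proof.
case/card_gt1P: card_C => A [B [CA CB neqAB]].
apply: leq_trans (codeword_dist CA CB neqAB) _.
by rewrite -(cardC CA) subset_leq_card ?subsetDl.
Qed.

Lemma codeword_neq0 A : A \in C -> exists x, x \in A.
Proof.
by move=> CA; apply/card_gt0P; rewrite cardC //; apply: ltn_trans k_gt2.
Qed.

(** The stabiliser of A is transitive on A and on its complement. An automorphism h taking A to
    another codeword moves some point w of A out of A, which fuses these two orbits. *)
Lemma point_transitive x y : exists2 g, g \in G & g x = y.
Proof.
case/card_gt1P: card_C => A [B [CA CB neqAB]].
have [h Gh hA] := codeword_transitive CA CB.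
have [z Bz A'z] : exists2 z, z \in B & z \notin A.
  by apply: codeword_outside => //; rewrite eq_sym.
have [w Aw hw] : exists2 w, w \in A & z = h w.
  by apply/imsetP; rewrite -hA.
have from_w u : exists2 g, g \in G & g w = u.
  have [Au | A'u] := boolP (u \in A).
    by have [g Gg [_ gw _]] := pair_transitive CA Aw Au A'z A'z; exists g.
  have [g Gg [_ _ gz]] := pair_transitive CA Aw Aw A'z A'u.
  by exists (h * g)%g; rewrite ?groupM // permM -hw gz.
have [f Gf <-] := from_w x; have [g Gg <-] := from_w y.
by exists (f^-1 * g)%g; rewrite ?groupM ?groupV // permM permK.
Qed.

(** * Equivalence of points, and the primitive case *)

(* The blocks of imprimitivity are the fibres of [words]. *)
Definition words x := [set A in C | x \in A].

Lemma words_perm g x :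
  g \in G -> words (g x) = [set g @: (A : {set X}) | A in words x].
Proof.
move=> Gg; apply/setP=> B.
have -> : B = g @: (g^-1 @: B)%g.
  by rewrite -imset_comp (eq_imset (g := id)) ?imset_id // => z /=;
    rewrite permKV.
rewrite (mem_imset _ _ (imset_inj (@perm_inj _ g))) !inE Aut_designP //.
by rewrite (mem_imset _ _ (@perm_inj _ g)).
Qed.

Lemma card_words x y : #|words x| = #|words y|.
Proof.
have [g Gg <-] := point_transitive x y.
by rewrite words_perm // card_imset //; apply/imset_inj/perm_inj.
Qed.

Lemma words_perm_eq g x y :
  g \in G -> (words (g x) == words (g y)) = (words x == words y).
Proof.
move=> Gg; rewrite !words_perm //.
by rewrite (inj_eq (imset_inj (imset_inj (@perm_inj _ g)))).
Qed.

(** All sets [words x] have the same size, so distinct ones are incomparable and the separating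
    codeword can be chosen to contain x rather than y. *)
Lemma separating_codeword x y : words x != words y ->
  exists2 A, A \in C & x \in A /\ y \notin A.
Proof.
move=> neqxy; have /subsetPn[A] : ~~ (words x \subset words y).
  by apply: contra neqxy => sxy; rewrite eqEcard sxy (card_words y x) leqnn.
by rewrite !inE => /andP[CA Ax]; rewrite CA => A'y; exists A.
Qed.

Lemma words_mem A x y : A \in C -> words x = words y -> (x \in A) = (y \in A).
Proof. by move=> CA /setP/(_ A); rewrite !inE CA. Qed.

(* Two codewords through [a] do not cover X, so a point outside both of them can
   serve as an intermediate step. *)
Lemma words_inj_transitive2 :
  injective words -> [transitive^2 G, on [set: X] | 'P].
Proof.
move=> inj_words.
have stab_tr a x y : x != a -> y != a ->
  exists2 g, g \in G & g a = a /\ g x = y.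
  move=> neqxa neqya.
  have [|A CA [Aa A'x]] := @separating_codeword a x.
    by rewrite (inj_eq inj_words) eq_sym.
  have [|B CB [Ba B'y]] := @separating_codeword a y.
    by rewrite (inj_eq inj_words) eq_sym.
  (* Both codewords contain a, so their union has at most 2k - 1 < v points. *)
  have [z ABz] : exists z, z \notin A :|: B.
    apply/existsP; rewrite -negb_forall; apply/negP=> /forallP allAB.
    have : #|A :|: B| = #|X| by apply/eq_card=> z; rewrite allAB.
    move: le_k; rewrite cardsU (cardC CA) (cardC CB) => le_2k eqX.
    have : 0 < #|A :&: B| by apply/card_gt0P; exists a; rewrite inE Aa.
    have := k_gt2; clear -le_2k eqX; lia.
  move: ABz; rewrite inE negb_or => /andP[A'z B'z].
  have [f Gf [_ fa fx]] := pair_transitive CA Aa Aa A'x A'z.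
  have [g Gg [_ ga gz]] := pair_transitive CB Ba Ba B'z B'y.
  by exists (f * g)%g; rewrite ?groupM // !permM fa fx.
have [A CA] : exists A, A \in C by apply/set0Pn; case: ct_C.
have [x0 Ax0] := codeword_neq0 CA.
have [y0 A'y0] : exists y, y \notin A.
  have [B CB neqBA] := other_codeword A.
  by have [y _ A'y] := codeword_outside CA CB neqBA; exists y.
apply: (@transitive2_perm _ _ x0 y0) => [|x y neqxy].
  by apply: contraNneq A'y0 => <-.
(* First move x0 to x, then correct the image of y0 inside the stabiliser of x. *)
have [h Gh hx0] := point_transitive x0 x.
have [||g Gg [gx gy]] := stab_tr x (h y0) y.
- by rewrite -hx0 (inj_eq perm_inj); apply: contraNneq A'y0 => ->.
- by rewrite eq_sym.
by exists (h * g)%g; rewrite ?groupM // !permM hx0.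
Qed.

Lemma words_fibre x y z : x != y -> words x = words y ->
  exists2 t, t != z & words t = words z.
Proof.
move=> neqxy eqxy; have [g Gg <-] := point_transitive x z.
exists (g y); first by rewrite (inj_eq perm_inj) eq_sym.
by apply/eqP; rewrite words_perm_eq // eqxy.
Qed.

(** * Replacing two points of a codeword by two outside points *)

Section Replace.

Variables A P : {set X}.
Hypotheses (CA : A \in C) (sPA : P \subset A) (card_P : #|P| = 2).
(** Deleting P loses no block met by A, so a block count after replacement depends only on the new
    points. The bound [distP] makes A a nearest codeword, which puts the new vertex in C_2. *)
Hypothesis wordsP : words @: (A :\: P) = words @: A.
Hypothesis distP : {in C, forall B, B != A -> 2 <= #|A :\: P :\: B|}.

Let replace x y := [set x; y] :|: (A :\: P).

Let replace_ksubset x y :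
  x != y -> x \notin A -> y \notin A -> replace x y \in ksubsets X k.
Proof.
move=> neqxy A'x A'y; rewrite in_ksubsets cardsU disjoint_setI0.
  by rewrite cards2 neqxy cardsDS // card_P cardC // cards0 subn0 subnKC //
    ltnW ?k_gt2.
rewrite disjoints_subset; apply/subsetP=> z /set2P[] ->.
  by rewrite !inE (negPf A'x) andbF.
by rewrite !inE (negPf A'y) andbF.
Qed.

Let replace_dist x y : x != y -> x \notin A -> y \notin A ->
  gdist_set (johnson k) C (replace x y) = 2.
Proof.
move=> neqxy A'x A'y.
have dA : replace x y :\: A = [set x; y].
  apply/setP=> z; rewrite !inE; case: (boolP (z \in A)) => [Az|_] /=.
    by apply/esym/norP; split; apply: contraTneq Az => ->.
  by rewrite andbF orbF.
apply: gdist_set_johnson => //; first exact: replace_ksubset.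
  move=> B CB; have [->|neqBA] := eqVneq B A; first by rewrite dA cards2 neqxy.
  by apply: leq_trans (distP CB neqBA) _;
    rewrite subset_leq_card ?setSD ?subsetUr.
by exists A; rewrite // dA cards2 neqxy.
Qed.

(* Otherwise replacing P by {x1, x2} and by {y1, y2} gives two vertices of the
   cell C_2 that meet different numbers of blocks. *)
Lemma replace_blocks x1 x2 y1 y2 :
    x1 \notin A -> x2 \notin A -> y1 \notin A -> y2 \notin A ->
    x1 != x2 -> words x1 = words x2 -> words y1 = words y2.
Proof.
move=> A'x1 A'x2 A'y1 A'y2 neqx eqx; apply/eqP/negPn/negP=> neqwy.
have neqy : y1 != y2 by apply: contraNneq neqwy => ->.
have [g Gg gE] : exists2 g, g \in G & replace y1 y2 = g @: replace x1 x2.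
  by apply: (completely_transitive_orbit ct_C);
    rewrite ?replace_ksubset ?replace_dist.
have card_g D : #|words @: (g @: D)| = #|words @: (D : {set X})|.
  pose gW (W : {set {set X}}) := [set g @: (B : {set X}) | B in W].
  have -> : words @: (g @: D) = gW @: (words @: D).
    by rewrite -!imset_comp; apply: eq_imset => x; apply: words_perm.
  exact/card_imset/(imset_inj (imset_inj (@perm_inj _ g))).
have wordsN z : z \notin A -> words z \notin words @: A.
  by move=> A'z; apply/imsetP=> -[w Aw /(words_mem CA)]; rewrite Aw (negPf A'z).
(* If A meets n blocks, the two vertices meet n + 1 and n + 2 blocks, yet g preserves this
   number. *)
have := card_g (replace x1 x2);
  rewrite -gE /replace !imsetU wordsP !imset_set1 -eqx setUid.
rewrite -setUA !cardsU1 in_setU1 (negPf neqwy) !wordsN // => /eqP.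
by rewrite !add1n !eqSS gtn_eqF.
Qed.

End Replace.

(** * Codewords that are single blocks *)

(** For a codeword this already makes A a full equivalence class, since by [words_mem] every point
    equivalent to a point of A lies in A. *)
Definition block A := {in A &, forall x y, words x = words y}.

Lemma block_codeword A B : A \in C -> B \in C -> block A -> block B.
Proof.
move=> CA CB blockA; have [g Gg ->] := codeword_transitive CA CB.
move=> _ _ /imsetP[x Ax ->] /imsetP[y Ay ->].
by apply/eqP; rewrite words_perm_eq // (blockA x y).
Qed.

Lemma block_disjoint A : A \in C -> block A ->
  {in C &, forall B D z, z \in B -> z \in D -> B = D}.
Proof.
move=> CA blockA B D CB CD z Bz Dz.
have blockB := block_codeword CA CB blockA.
apply/eqP; rewrite eqEcard !cardC // leqnn andbT; apply/subsetP=> t Bt.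
by rewrite (words_mem CD (blockB t z Bt Bz)).
Qed.

(** Another codeword B has a point outside A, hence contains the whole complement. That complement
    has v - k >= k = |B| points, so it equals B. *)
Lemma block_complement A : A \in C ->
    {in ~: A &, forall x y, words x = words y} ->
  ~: A \in C.
Proof.
move=> CA blockA'; have [B CB neqBA] := other_codeword A.
have [z Bz A'z] := codeword_outside CA CB neqBA.
suff -> : ~: A = B by [].
apply/eqP; rewrite eqEcard (cardC CB) cardsCs setCK (cardC CA).
apply/andP; split.
  by apply/subsetP=> t A't; rewrite (words_mem CB (blockA' t z A't _)) ?inE.
by rewrite leq_psubRL ?addnn -?mul2n // (ltn_trans _ k_gt2).
Qed.

(** If A met two blocks, [replace_blocks] would make its complement a single block. The complement
    would then be a codeword, and transitivity on codewords would make A a block too. *)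
Lemma imprimitive_block A x y : A \in C -> x != y -> words x = words y ->
  block A.
Proof.
move=> CA neqxy eqxy; have fibre := words_fibre _ neqxy eqxy.
case: (boolP [forall u in A, forall v in A, words u == words v]) => [|nblock].
  move=> blockA u v Au Av; apply/eqP.
  by move: blockA => /forall_inP/(_ u Au)/forall_inP/(_ v Av).
have {nblock} [a1 Aa1 [a2 Aa2 neqa]] :
  exists2 a1, a1 \in A & exists2 a2, a2 \in A & words a1 != words a2.
  move: nblock; rewrite negb_forall_in => /exists_inP[a1 Aa1].
  by rewrite negb_forall_in => /exists_inP[a2 Aa2 neqa]; exists a1 => //;
    exists a2.
(* The partners b1 and b2 stay in A when a1 and a2 are deleted, and still represent their blocks. *)
have [b1 neqb1 eqb1] := fibre a1; have [b2 neqb2 eqb2] := fibre a2.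
have Ab1 : b1 \in A by rewrite (words_mem CA eqb1).
have Ab2 : b2 \in A by rewrite (words_mem CA eqb2).
have P'b1 : b1 \notin [set a1; a2].
  by rewrite !inE (negPf neqb1); apply: contraNneq neqa => <-; apply/eqP.
have P'b2 : b2 \notin [set a1; a2].
  by rewrite !inE (negPf neqb2) orbF; apply: contraNneq neqa => <-; apply/eqP.
have neqb : b1 != b2 by apply: contraNneq neqa => eqb; rewrite -eqb1 -eqb2 eqb.
have repl x1 x2 y1 y2 :
  x1 \notin A -> x2 \notin A -> y1 \notin A -> y2 \notin A ->
  x1 != x2 -> words x1 = words x2 -> words y1 = words y2.
  apply: (@replace_blocks A [set a1; a2]) => //.
  - by apply/subsetP=> z /set2P[] ->.
  - by rewrite cards2 (contraNneq _ neqa) // => ->.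
  - apply/eqP; rewrite eqEsubset imsetS ?subsetDl //=;
    apply/subsetP=> _ /imsetP[z Az ->].
    have [/set2P[] ->|P'z] := boolP (z \in [set a1; a2]).
    + by rewrite -eqb1 imset_f // inE P'b1.
    + by rewrite -eqb2 imset_f // inE P'b2.
    + by rewrite imset_f // inE P'z.
  move=> B CB neqBA.
  have dAB : 2 < #|A :\: B| by apply: codeword_dist; rewrite // eq_sym.
  rewrite setDDl setUC -setDDl.
  (* If B misses a1 and a2, it misses b1 and b2, which are the two points wanted. Otherwise deleting
     a1 and a2 removes at most one of the three or more points of A \ B. *)
  have [/andP[B'a1 B'a2]|] := boolP ((a1 \notin B) && (a2 \notin B)).
    apply/card_gt1P; exists b1, b2; split=> //.
    + by rewrite in_setD P'b1 in_setD Ab1 (words_mem CB eqb1) B'a1.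
    + by rewrite in_setD P'b2 in_setD Ab2 (words_mem CB eqb2) B'a2.
  move=> Ba; have le1 : #|(A :\: B) :&: [set a1; a2]| <= 1.
    rewrite -ltnS; apply: (@leq_trans #|[set a1; a2]|);
      last by rewrite cards2; case: eqP.
    apply/proper_card/properP; split; first exact: subsetIr.
    by move: Ba; rewrite negb_and !negbK => /orP[] b; [exists a1 | exists a2];
      rewrite ?set21 ?set22 // in_setI in_setD b.
  rewrite -ltnS; apply: leq_trans dAB _.
  by rewrite -(cardsID [set a1; a2] (A :\: B)) -add1n leq_add2r.
have blockA' : {in ~: A &, forall u v, words u = words v}.
  (* The partner t of u also lies outside A, so t and u form the equivalent pair required by
     [repl]. *)
  move=> u v; rewrite !inE => A'u A'v; have [t nequt equt] := fibre u.
  have A't : t \notin A by rewrite (words_mem CA equt).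
  exact: (repl t u u v).
exact: block_codeword (block_complement CA blockA') CA blockA'.
Qed.

End CompletelyTransitive.

Theorem theorem4p1 (X : finType) (v k : nat) (C : {set {set X}})
    (alpha : {set X}) (card_X : #|X| = v) (le_k : 2 * k <= v)
    (ct_C : completely_transitive k C) (card_C : 2 <= #|C|)
    (delta_C : 3 <= min_gdist (johnson k) C) (alpha_C : alpha \in C) :
  [transitive 'C_(Aut_design C)[alpha | 'P^*], on setX alpha (~: alpha)
     | pair_action X] /\
  ((v = 2 * k /\ 6 <= v /\
    exists A B : {set X},
      [/\ #|A| = k, #|B| = k, [disjoint A & B] & C = [set A; B]])
   \/ (exists b : nat,
        [/\ v = 3 * b, #|C| = b, trivIset C & {in C, forall A : {set X}, #|A| = 3}])
   \/ [transitive^2 Aut_design C, on [set: X] | 'P]).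
Proof.
subst v; have gt2k := k_gt2 ct_C card_C delta_C.
have cardC (A : {set X}) : A \in C -> #|A| = k.
  by case: ct_C => _ /subsetP subC _ /subC; rewrite in_ksubsets => /eqP.
have [a0 Aa0] := codeword_neq0 ct_C card_C delta_C alpha_C.
split.
  have [B CB neqB] := other_codeword card_C alpha.
  have [z0 _ A'z0] := codeword_outside ct_C alpha_C CB neqB.
  apply/imsetP; exists (a0, z0); first by rewrite in_setX inE Aa0.
  apply/setP=> -[b y]; rewrite in_setX inE /=;
    apply/idP/imsetP=> [/andP[Ab A'y]|[g]].
    have [g Gg [gA ga gz]] :=
      pair_transitive ct_C delta_C alpha_C Aa0 Ab A'z0 A'y.
    exists g; first by rewrite inE Gg; apply/astab1P.
    by rewrite /= /pair_perm /= ga gz.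
  case/setIP=> _ /astab1P gA [-> ->].
  have memA x : (g x \in alpha) = (x \in alpha).
    by rewrite -{1}gA; apply: mem_imset; apply: perm_inj.
  by rewrite !memA Aa0.
have [/injectiveP inj_words|/injectivePn[x [y neqxy eqxy]]] :=
  boolP (injectiveb (words C)).
  by right; right; apply: (words_inj_transitive2 le_k ct_C).
have blockA := imprimitive_block le_k ct_C card_C delta_C alpha_C neqxy eqxy.
have disjC := block_disjoint ct_C alpha_C blockA.
have trivC : trivIset C.
  apply/trivIsetP=> A B CA CB; apply: contraR => /pred0Pn[z /andP[Az Bz]].
  by apply/eqP/(disjC A B CA CB z).
(* The codewords are now pairwise disjoint blocks. A complement that is one block gives case (a),
   and one that is not forces k = 3. *)
have [/forall_inP blockA'|] :=
    boolP [forall u in ~: alpha, forall w in ~: alpha, words C u == words C w].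
  have CA' : ~: alpha \in C.
    apply: (block_complement le_k ct_C card_C delta_C alpha_C) => u w A'u A'w.
    by apply/eqP; move: w A'w; apply/forall_inP/blockA'.
  left; have eqX : #|X| = 2 * k
    by rewrite mul2n -addnn -{1}(cardC _ alpha_C) -(cardC _ CA') cardsC.
  split=> //; split; first by rewrite eqX -[6]/(2 * 3) leq_mul2l.
  exists alpha, (~: alpha); split;
    [exact: cardC | exact: cardC | by rewrite -setI_eq0 setICr |].
  apply/eqP; rewrite eqEsubset; apply/andP; split; apply/subsetP=> B;
    last by case/set2P=> ->.
  move=> CB; apply/set2P; have [|neqB] := eqVneq B alpha; [by left | right].
  have [z Bz A'z] := codeword_outside ct_C alpha_C CB neqB.
  by apply: (disjC B _ CB CA' z); rewrite ?inE.
rewrite negb_forall_in => /exists_inP[y1 A'y1].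
rewrite negb_forall_in => /exists_inP[y2 A'y2 neqwy].
rewrite !inE in A'y1 A'y2.
(* For k > 3, deleting two points of alpha leaves at least two. These represent the only block in
   alpha and avoid every other codeword, so [replace_blocks] would make y1 and y2 equivalent. *)
have k3 : k = 3.
  apply/eqP; rewrite eqn_leq gt2k andbT leqNgt; apply/negP=> gt3k.
  have [a1 [a2 [Aa1 Aa2 neqa]]] :
    exists a1 a2, [/\ a1 \in alpha, a2 \in alpha & a1 != a2].
    by apply/card_gt1P; rewrite cardC // ltnW.
  have sPA : [set a1; a2] \subset alpha by apply/subsetP=> z /set2P[] ->.
  have card_P : #|[set a1; a2]| = 2 by rewrite cards2 neqa.
  have card_AP : 2 <= #|alpha :\: [set a1; a2]|.
    by rewrite cardsDS // card_P cardC // leq_subRL // ltnW.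
  have [c] : exists c, c \in alpha :\: [set a1; a2] by apply/card_gt0P/ltnW.
  rewrite inE => /andP[P'c Ac].
  have [t neqt eqt] := words_fibre ct_C card_C delta_C y1 neqxy eqxy.
  have A't : t \notin alpha by rewrite (words_mem alpha_C eqt).
  move/eqP: neqwy; apply.
  apply: (replace_blocks ct_C card_C delta_C alpha_C sPA card_P _ _ A't A'y1
    A'y1 A'y2 neqt eqt).
    apply/eqP; rewrite eqEsubset imsetS ?subsetDl //=.
    apply/subsetP=> _ /imsetP[z Az ->]; rewrite (blockA z c Az Ac).
    by rewrite imset_f // inE P'c.
  move=> B CB neqB.
  suff -> : alpha :\: [set a1; a2] :\: B = alpha :\: [set a1; a2] by [].
  apply/setP=> z; rewrite in_setD; case: (boolP (z \in B)) => //= Bz.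
  apply/esym/negbTE; rewrite inE negb_and; apply/orP; right.
  by apply: contra neqB => Az; apply/eqP/(disjC B alpha CB alpha_C z).
right; left; exists #|C|; subst k; split=> //.
rewrite mulnC -cardsT; apply: (card_uniform_partition cardC).
apply/and3P; split=> //; last by apply/negP=> /cardC; rewrite cards0.
(* Point transitivity places every z in an image of alpha, so the codewords cover X. *)
apply/eqP/setP=> z; rewrite inE; apply/bigcupP.
have [g Gg <-] := point_transitive ct_C card_C delta_C a0 z.
by exists (g @: alpha); rewrite ?Aut_designP ?imset_f.
Qed.
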